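(* Let $k\geq 3$ and let $H$ be a non-empty tree. Then $H\succcurlyeq S_k$ if and only if $e(H)\geq (k-1)\sigma(H)$, where $S_k$ is the star with $k$ vertices.
   Context: All graphs are finite, simple and undirected; a graph is non-empty if it has at least one edge; $v(\cdot)$, $e(\cdot)$ denote numbers of vertices and edges. $t(H,G)=\hom(H,G)/v(G)^{v(H)}$, where $\hom(H,G)$ is the number of graph homomorphisms from $H$ to $G$. For non-empty graphs $H,T$, $H\succcurlyeq T$ means $t(H,G)^{e(T)}\geq t(T,G)^{e(H)}$ for every graph $G$. For a bipartite graph $H$, $\sigma(H)$ is the minimum of $|A|$ over all bipartitions $(A,B)$ of $H$ (partitions of $V(H)$ into two independent sets). *)

(* Defs.v *)
From mathcomp Require Import all_boot all_order all_algebra.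

Set Implicit Arguments.
Unset Strict Implicit.
Unset Printing Implicit Defensive.

Import Order.TTheory GRing.Theory Num.Theory.

Record sgraph := SGraph {
  vertex :> finType;
  adj : rel vertex;
  adj_sym : symmetric adj;
  adj_irrefl : irreflexive adj
}.

Definition num_vertices (G : sgraph) : nat := #|G|.

Definition edges (G : sgraph) : {set {set G}} :=
  [set [set p.1; p.2] | p : G * G & adj p.1 p.2].

Definition num_edges (G : sgraph) : nat := #|edges G|.

Definition nonempty (G : sgraph) : Prop := 0 < num_edges G.

Definition is_hom (H G : sgraph) (f : {ffun H -> G}) : bool :=
  [forall x, forall y, adj x y ==> adj (f x) (f y)].

Definition num_homs (H G : sgraph) : nat :=
  #|[set f : {ffun H -> G} | is_hom f]|.

Definition hom_density (H G : sgraph) : rat :=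
  ((num_homs H G)%:R / (num_vertices G)%:R ^+ num_vertices H)%R.

(* A graph G without vertices, for which the density is a division by zero,
   has no effect on this definition: for non-empty H and T both densities are
   then 0, and the condition reads 0 <= 0. *)
Definition dominates (H T : sgraph) : Prop :=
  forall G : sgraph,
    (hom_density T G ^+ num_edges H <= hom_density H G ^+ num_edges T)%R.

Definition connected_graph (G : sgraph) : Prop :=
  0 < num_vertices G /\ forall x y : G, connect (@adj G) x y.

(* In [ucycle], a single edge traversed back and forth counts as a cycle of
   length 2; the cycles of a simple graph are those of length at least 3. *)
Definition acyclic (G : sgraph) : Prop :=
  forall c : seq G, ucycle (@adj G) c -> size c < 3.

Definition is_tree (G : sgraph) : Prop := connected_graph G /\ acyclic G.

Definition independent (G : sgraph) (A : {set G}) : bool :=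
  [forall x in A, forall y in A, ~~ adj x y].

Definition bipartition (G : sgraph) (A B : {set G}) : bool :=
  [&& A :|: B == [set: G], [disjoint A & B], independent A & independent B].

(* The default value #|G| of the minimum bounds every #|A|, so it is only
   relevant when G is not bipartite. *)
Definition sigma (G : sgraph) : nat :=
  \big[minn/#|G|]_(p : {set G} * {set G} | bipartition p.1 p.2) #|p.1|.

(* Vertex 0 is the centre: two vertices are adjacent when exactly one of them
   is 0. *)
Definition star_adj (k : nat) : rel 'I_k :=
  fun i j => (val i == 0) (+) (val j == 0).

Lemma star_adj_sym k : symmetric (@star_adj k).
Proof. by move=> i j; rewrite /star_adj addbC. Qed.

Lemma star_adj_irrefl k : irreflexive (@star_adj k).
Proof. by move=> i; rewrite /star_adj addbb. Qed.

(* The star with k vertices (k.-1 edges), not the one with k leaves. *)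
Definition star (k : nat) : sgraph :=
  SGraph (@star_adj_sym k) (@star_adj_irrefl k).

(* Main.v *)
Require Import Defs.
From mathcomp Require Import all_boot all_order all_algebra.
From mathcomp Require Import reals exp Rstruct.
From mathcomp Require Import zify ring lra.

(* Write n = k - 1, m = e(H), a = sigma(H), N = v(G), d = degree in G.

   Necessity: in the star with N leaves, every homomorphism from H sends a
   class of a bipartition of H, hence at least a vertices, to the centre, so
   hom(H) = O(N^(m + 1 - a)), whereas hom(S_k) >= N^n; let N tend to infinity.

   Sufficiency is an entropy argument. Let (X, Y) be the random edge of G where
   X = x with probability p(x) = d(x)^n / hom(S_k) and Y is a uniform
   neighbour of X, and let D = E[log d(X)]. Then log hom(S_k) = h(X) + n D. The
   Markov field on the tree H all of whose edges have the law of (X, Y), with X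
   on the class A of size a, gives
     log hom(H) >= m D + a h(X) - (a - 1) h(Y) >= m D + a h(X) - (a - 1) log N.
   Since h(X) <= log N and n a <= m, this implies the required inequality
     m log hom(S_k) + n (m + 1) log N <= n log hom(H) + m (n + 1) log N.
   The lower bound on hom(H) is proved without the Markov field, by summing out
   the leaves of H one at a time with the log-sum inequality. *)

Set Implicit Arguments.
Unset Strict Implicit.
Unset Printing Implicit Defensive.

Import Order.TTheory GRing.Theory Num.Theory.

(** * Growing a tree leaf by leaf *)

(** The last premise of [grown_leaf] makes [v] a leaf of the subgraph induced on [v |: S], so
    induction on this predicate is leaf removal with [r] kept to the end. *)
Inductive grown (H : sgraph) (r : H) : {set H} -> Prop :=
| grown_root : grown r [set r]
| grown_leaf (S : {set H}) (u v : H) :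
    grown r S -> u \in S -> v \notin S -> adj u v ->
    (forall w, w \in S -> adj w v -> w = u) -> grown r (v |: S).

Section Grown.
Variables (H : sgraph) (r : H).

Lemma grown_root_in (S : {set H}) : grown r S -> r \in S.
Proof. by elim=> [|S' u v _ rS *]; rewrite !inE ?eqxx // rS orbT. Qed.

Definition induced_adj (S : {set H}) : rel H :=
  [rel x y | [&& x \in S, y \in S & adj x y]].

Lemma induced_adj_connect_sym (S : {set H}) : connect_sym (induced_adj S).
Proof.
by apply: sym_connect_sym => x y; rewrite /induced_adj /= andbCA adj_sym.
Qed.

Lemma grown_connect (S : {set H}) :
  grown r S -> {in S, forall x, connect (induced_adj S) r x}.
Proof.
elim=> [x /set1P->|S' u v gS IH uS vS uv _ x]; first exact: connect0.
have sub y : y \in S' -> connect (induced_adj (v |: S')) r y.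
  move=> /IH; apply: connect_sub => a b /and3P[aS bS ab].
  by apply: connect1; rewrite /induced_adj /= !inE aS bS ab !orbT.
rewrite !inE => /orP[/eqP->|]; last exact: sub.
apply: connect_trans (sub u uS) (connect1 _).
by rewrite /induced_adj /= !inE uS eqxx uv !orbT.
Qed.

(** Distinct [u] and [w] would be joined by a simple path inside [S]; since [v] lies outside [S], it
    would close this path to a cycle of length at least 3. *)
Lemma acyclic_unique_neighbour (S : {set H}) (u v w : H) :
  acyclic H -> grown r S -> v \notin S ->
  u \in S -> w \in S -> adj u v -> adj w v -> w = u.
Proof.
move=> acyc gS vS uS wS uv wv; apply/eqP/negPn/negP => neq.
have : connect (induced_adj S) u w.
  apply: connect_trans (grown_connect gS wS).
  by rewrite induced_adj_connect_sym grown_connect.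
case/connectP=> p0 /shortenP[p pth un _ wl].
have pS : {subset u :: p <= S}.
  elim: p u uS pth {un wl neq p0 uv} => [|y p IH] x xS /= => [_|/andP[/and3P[_ yS _] pth]] z.
    by rewrite inE => /eqP->.
  by rewrite inE => /orP[/eqP->//|]; apply: IH.
case: p pth un wl pS => [|y p] pth un wl pS; first by rewrite wl eqxx in neq.
have vp : v \notin u :: y :: p by apply: contra vS => /pS.
suff /acyc : ucycle (@adj H) (v :: u :: y :: p) by [].
apply/andP; split; last by rewrite cons_uniq vp.
rewrite /= in wl; rewrite (cycle_path v) /= -wl wv adj_sym uv /=.
by apply: sub_path pth => a b /and3P[].
Qed.

(** Greedy growth: connectedness supplies an edge leaving [S], and acyclicity makes its outer end a
    leaf. *)
Lemma tree_grown : is_tree H -> grown r [set: H].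
Proof.
move=> [[_ conn] acyc].
suff [S gS /eqP] : exists2 S, grown r S & #|S| == #|H|.
  by rewrite -cardsT => cS; have /eqP <- : S == setT by rewrite eqEcard subsetT cS leqnn.
suff grow n : n <= #|H| -> exists2 S, grown r S & n <= #|S|.
  have [S gS cS] := grow _ (leqnn _).
  by exists S => //; rewrite eqn_leq cS max_card.
elim: n => [_|n IH nH]; first by exists [set r] => //; exact: grown_root.
have [S gS nS] := IH (ltnW nH).
have [ltS|] := boolP (n < #|S|); first by exists S.
rewrite -leqNgt => Sn.
have [/existsP[u /existsP[v /and3P[uS vS uv]]]|noedge] :=
  boolP [exists u, [exists v, [&& u \in S, v \notin S & adj u v]]].
  exists (v |: S); last by rewrite cardsU1 vS.
  apply: (grown_leaf gS uS vS uv) => w wS wv.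
  exact: (acyclic_unique_neighbour acyc gS vS uS wS uv wv).
(* With no edge leaving it, [S] is closed under adjacency, hence all of [H], against
   [#|S| <= n < #|H|]. *)
have clS : closed (@adj H) (mem S).
  apply: (intro_closed (sym_connect_sym (@adj_sym H))) => x y xy xS.
  apply: contraNT noedge => yS.
  by apply/existsP; exists x; apply/existsP; exists y; apply/and3P.
have S_full : S = setT.
  apply/setP=> x; rewrite inE.
  by have <- := closed_connect clS (conn r x); apply: grown_root_in.
by move: Sn; rewrite S_full cardsT leqNgt nH.
Qed.

(** Each new leaf [v] contributes exactly one edge, the one to [u]. *)
Lemma grown_num_edges (S : {set H}) :
  grown r S -> #|[set e in edges H | e \subset S]|.+1 = #|S|.
Proof.
elim=> [|S' u v gS IH uS vS uv uniq].
  rewrite cards1; congr _.+1; apply/eqP; rewrite cards_eq0 -subset0.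
  apply/subsetP=> e; rewrite inE => /andP[/imsetP[[x y] /= xy ->]].
  rewrite subUset !sub1set !inE => /andP[/eqP xr /eqP yr].
  by move: xy; rewrite inE /= xr yr adj_irrefl.
rewrite cardsU1 vS -IH add1n; congr _.+1.
suff -> : [set e in edges H | e \subset v |: S'] =
          [set u; v] |: [set e in edges H | e \subset S'].
  rewrite cardsU1 inE subUset !sub1set (negPf vS) !andbF; lia.
apply/setP=> e; rewrite !inE; apply/andP/orP.
- case=> /imsetP[[x y]]; rewrite inE /= => xy ->.
  have ein a b : adj a b -> [set a; b] \in edges H.
    by move=> ab; apply/imsetP; exists (a, b); rewrite ?inE.
  rewrite !subUset !sub1set !inE => /andP[/orP[/eqP xv|xS] /orP[/eqP yv|yS]].
  + by rewrite xv yv adj_irrefl in xy.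
  + by left; rewrite setUC xv (uniq y) // adj_sym -xv.
  + by left; rewrite yv (uniq x) // -yv.
  + by right; rewrite ein ?xS.
- case=> [/eqP->|/andP[eE eS]]; split => //.
  + by apply/imsetP; exists (u, v); rewrite ?inE.
  + by rewrite subUset !sub1set !inE eqxx uS orbT.
  + exact: subset_trans eS (subsetUr _ _).
Qed.
End Grown.

Lemma tree_num_edges (H : sgraph) : is_tree H -> (num_edges H).+1 = #|H|.
Proof.
move=> Ht; have [[/card_gt0P[r _] _] _] := Ht.
rewrite -cardsT -(grown_num_edges (tree_grown r Ht)); congr _.+1.
by apply: eq_card => e; rewrite !inE subsetT andbT.
Qed.

(** * Bipartitions and the parameter [sigma] *)

Lemma sigma_le (H : sgraph) (A B : {set H}) : bipartition A B -> sigma H <= #|A|.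
Proof.
move=> AB; rewrite /sigma -minEnat -leEnat.
exact: (bigmin_le_cond _ (fun p : {set H} * {set H} => #|p.1|) (j := (A, B))).
Qed.

Lemma sigma_attained (H : sgraph) :
  sigma H = #|H| \/ exists A B : {set H}, bipartition A B /\ #|A| = sigma H.
Proof.
rewrite /sigma.
elim/big_ind: _ => [|x y|[A B] AB]; first by left.
  by rewrite /minn; case: ifP.
by right; exists A, B.
Qed.

(** * Homomorphism counts out of and into stars *)

Definition degree (G : sgraph) (x : G) : nat := #|[set y | adj x y]|.

(** Once the centre is sent to [x], the [n] leaves go independently to neighbours of [x]. *)
Lemma num_homs_star (n : nat) (G : sgraph) :
  num_homs (star n.+1) G = \sum_(x : G) degree x ^ n.
Proof.
rewrite /num_homs cardsE -sum1_card (partition_big (fun f : {ffun star n.+1 -> G} => f ord0) predT) //=.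
apply: eq_bigr => x _; rewrite sum1_card.
pose F (i : 'I_n.+1) := if i == ord0 then pred1 x else [pred y : G | adj x y].
transitivity #|(family F : {pred {ffun star n.+1 -> G}})|.
  apply: eq_card => f; rewrite !inE; apply/andP/familyP.
  - case=> /forallP hf /eqP fx i; rewrite /F; case: eqP => [->|i0]; first by rewrite inE fx.
    rewrite inE -fx; have /forallP/(_ i)/implyP := hf ord0; apply.
    by rewrite /= /star_adj /=; case: i i0 => [[|i] hi] // [] ; apply: val_inj.
  - move=> hf; have f0 : f ord0 = x by have := hf ord0; rewrite /F eqxx inE => /eqP.
    rewrite f0 eqxx; split => //.
    apply/forallP=> i; apply/forallP=> j; apply/implyP; rewrite /= /star_adj => ij.
    have [i0|i0] := eqVneq i ord0; have [j0|j0] := eqVneq j ord0.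
    + by move: ij; rewrite i0 j0.
    + by have := hf j; rewrite /F (negPf j0) inE i0 f0.
    + by have := hf i; rewrite /F (negPf i0) inE j0 f0 adj_sym.
    + by move: ij i0 j0; rewrite -!val_eqE /=; do 2![case: (val _ == 0)].
rewrite card_family foldrE big_map -[LHS]/(\prod_(i <- enum 'I_n.+1) _) big_enum /=.
rewrite big_ord_recl /F eqxx card1 mul1n.
rewrite (eq_bigr (fun=> degree x)) ?prod_nat_const ?card_ord // => i _.
by rewrite /degree cardsE.
Qed.

(** Homomorphisms are sorted by the preimage [A] of the centre. If some homomorphism has this
    preimage, [A] is a class of a bipartition, so at most [#|H| - sigma H] vertices are left, each
    with [N] possible images. *)
Lemma num_homs_to_star (H : sgraph) (N : nat) : 0 < N ->
  num_homs H (star N.+1) <= 2 ^ #|H| * N ^ (#|H| - sigma H).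
Proof.
move=> N0; rewrite /num_homs cardsE -sum1_card.
pose zeros (f : {ffun H -> star N.+1}) := [set v | f v == ord0 :> 'I_N.+1].
rewrite (partition_big zeros predT) //.
have -> : 2 ^ #|H| * N ^ (#|H| - sigma H) = \sum_(A : {set H}) N ^ (#|H| - sigma H).
  rewrite sum_nat_const -[in LHS]cardsT -card_powerset powersetT cardsE.
  by rewrite cardsT.
apply: leq_sum => A _; rewrite sum1_card.
have [/card_gt0P[f0]|] := ltnP 0 (#|[pred f | is_hom f & zeros f == A]|); last first.
  by move=> /leq_trans; apply.
rewrite !inE => /andP[/forallP hf0 /eqP zA].
have hom0 x y : adj x y -> (x \in A) (+) (y \in A).
  move=> xy; rewrite -zA !inE.
  by have /forallP/(_ y)/implyP/(_ xy) := hf0 x; rewrite /= /star_adj -!val_eqE.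
have bA : bipartition A (~: A).
  apply/and4P; split; first by rewrite setUCr.
  - by rewrite disjoints_subset setCK.
  - apply/forallP=> x; apply/implyP=> xA; apply/forallP=> y; apply/implyP=> yA.
    by apply/negP=> /hom0; rewrite xA yA.
  - apply/forallP=> x; apply/implyP=> xA; apply/forallP=> y; apply/implyP=> yA.
    by move: xA yA; rewrite !inE => /negPf xA /negPf yA; apply/negP=> /hom0; rewrite xA yA.
pose F (v : H) := if v \in A then pred1 (ord0 : 'I_N.+1) else predC1 (ord0 : 'I_N.+1).
apply: (@leq_trans #|(family F : {pred {ffun H -> star N.+1}})|).
  apply/subset_leq_card/subsetP=> f; rewrite !inE => /andP[_ /eqP zf].
  by apply/familyP=> v; rewrite /F -zf inE; case: eqP => fv; rewrite !inE ?fv //; apply/eqP.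
rewrite card_family foldrE big_map -[X in X <= _]/(\prod_(i <- enum H) _) big_enum /=.
rewrite (bigID (mem A)) /= big1 ?mul1n; last by move=> v vA; rewrite /F vA card1.
rewrite (eq_bigr (fun=> N)); last first.
  by move=> v /negPf vA; rewrite /F vA cardC1 card_ord.
rewrite prod_nat_const leq_pexp2l //.
have -> : #|[pred i | i \notin A]| = #|~: A| by apply: eq_card => v; rewrite !inE.
by rewrite cardsCs setCK leq_sub2l // (sigma_le bA).
Qed.

(** * The random edge of a graph *)

Section Entropy.
Local Open Scope ring_scope.
Variable R : realType.

(** The log-sum inequality, obtained by summing [ln z <= z - 1] with weights [a i]. The last
    hypothesis is absolute continuity of [a] with respect to [b]. *)
Lemma log_sum (I : finType) (a b : I -> R) :
  (forall i, 0 <= a i) -> (forall i, 0 <= b i) -> (forall i, 0 < a i -> 0 < b i) ->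
  \sum_i a i * (ln (b i) - ln (a i)) <=
  (\sum_i a i) * (ln (\sum_i b i) - ln (\sum_i a i)).
Proof.
move=> a0 b0 ab; set s := \sum_i a i; set t := \sum_i b i.
have s0 : 0 <= s by apply: sumr_ge0.
have [sz|s_neq0] := eqVneq s 0.
  have az i : a i = 0.
    by apply/eqP; move/eqP: sz; rewrite psumr_eq0 // => /allP; apply; rewrite mem_index_enum.
  by rewrite sz mul0r big1 // => i _; rewrite az mul0r.
have sp : 0 < s by rewrite lt_def s_neq0.
have tp : 0 < t.
  have [i ai] : exists i, 0 < a i.
    apply/existsP; apply: contraNT s_neq0; rewrite negb_exists => /forallP h.
    by apply/eqP/big1 => i _; apply/eqP; rewrite eq_le a0 leNgt h.
  rewrite /t (bigD1 i) //=; apply: ltr_pwDl; first exact: ab.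
  exact: sumr_ge0.
(* The added terms [b i * (s / t) - a i] sum to zero; with them the inequality holds summand by
   summand. *)
rewrite -subr_ge0; have -> : s * (ln t - ln s) = \sum_i (a i * (ln t - ln s) + (b i * (s / t) - a i)).
  rewrite big_split sumrB /= -!mulr_suml -/s -/t.
  by field; rewrite gt_eqF.
rewrite -sumrB; apply: sumr_ge0 => i _.
have [->|ai_neq0] := eqVneq (a i) 0.
  by rewrite !mul0r add0r !subr0 mulr_ge0 // divr_ge0 // ltW.
have ai : 0 < a i by rewrite lt_def ai_neq0 a0.
have bi := ab i ai.
pose z := b i * (s / t) / a i.
have zp : 0 < z by rewrite !(mulr_gt0, divr_gt0, invr_gt0).
have : ln z <= z - 1.
  by rewrite -[X in ln X](subrKC 1) le_ln1Dx // ltrBrDl subrr.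
have -> : ln z = ln (b i) + (ln s - ln t) - ln (a i).
  by rewrite /z !(ln_div, lnM) // posrE ?mulr_gt0 ?divr_gt0 ?invr_gt0.
move=> /(ler_wpM2l (a0 i)).
have -> : a i * (z - 1) = b i * (s / t) - a i.
  by rewrite /z; field; rewrite (gt_eqF tp) ai_neq0.
lra.
Qed.

Section Law.
Variable G : sgraph.

(** Positivity is asked only off isolated vertices, because absorbing a leaf turns the weight at an
    isolated vertex into an empty sum, that is 0. *)
Definition admissible (g : G -> R) : Prop :=
  (forall x, 0 <= g x) /\ (forall x, (0 < degree x)%N -> 0 < g x).

Lemma adj_degree_gt0 (x y : G) : adj x y -> (0 < degree x)%N.
Proof. by move=> xy; apply/card_gt0P; exists y; rewrite inE. Qed.

Lemma admissible_sum_adj (g : G -> R) (x : G) :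
  admissible g -> (0 < degree x)%N -> 0 < \sum_(y | adj x y) g y.
Proof.
case=> g0 gp /card_gt0P[y]; rewrite inE => xy.
rewrite (bigD1 y) //=; apply: ltr_pwDl.
  by apply: gp; apply: (@adj_degree_gt0 y x); rewrite adj_sym.
by apply: sumr_ge0 => *; exact: g0.
Qed.

Variable p : G -> R.
Hypothesis p_admissible : admissible p.
Hypothesis p_isolated : forall x, degree x = 0%N -> p x = 0.
Hypothesis p_sum1 : \sum_x p x = 1.

(* The joint law of (X, Y) and the law of Y, where X has law p and Y is a
   uniform neighbour of X. *)
Definition edge_law (x y : G) : R := if adj x y then p x / (degree x)%:R else 0.
Definition end_law (y : G) : R := \sum_x edge_law x y.
Definition mean_log_degree : R := \sum_x p x * ln (degree x)%:R.
Definition entropy : R := - \sum_x p x * ln (p x).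

Lemma p_gt0_degree x : 0 < p x -> (0 < degree x)%N.
Proof. by apply: contraTltn; rewrite leqn0 => /eqP/p_isolated->; rewrite ltxx. Qed.

Lemma edge_law_ge0 x y : 0 <= edge_law x y.
Proof. by rewrite /edge_law; case: ifP => // _; rewrite divr_ge0 // p_admissible.1. Qed.

Lemma sum_edge_law x : \sum_y edge_law x y = p x.
Proof.
rewrite -big_mkcond sumr_const.
have -> : #|[pred y | adj x y]| = degree x by rewrite /degree cardsE.
have [dx|dx] := posnP (degree x); first by rewrite dx p_isolated.
by rewrite -[LHS]mulr_natr divfK // pnatr_eq0 -lt0n.
Qed.

Lemma sum_end_law_mean (phi : G -> R) :
  \sum_y end_law y * phi y = \sum_x \sum_y edge_law x y * phi y.
Proof. by rewrite exchange_big; apply: eq_bigr => y _; rewrite mulr_suml. Qed.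

Lemma sum_edge_law_mean (phi : G -> R) :
  \sum_y \sum_x edge_law x y * phi x = \sum_x p x * phi x.
Proof.
by rewrite exchange_big; apply: eq_bigr => y _; rewrite -mulr_suml sum_edge_law.
Qed.

Lemma sum_end_law : \sum_y end_law y = 1.
Proof. by rewrite exchange_big -p_sum1; apply: eq_bigr => x _; rewrite sum_edge_law. Qed.

Lemma end_law_ge0 y : 0 <= end_law y.
Proof. by apply: sumr_ge0 => x _; exact: edge_law_ge0. Qed.

Lemma end_law_isolated y : degree y = 0%N -> end_law y = 0.
Proof.
move=> dy; apply: big1 => x _; rewrite /edge_law; case: ifP => // xy.
by have := @adj_degree_gt0 y x; rewrite adj_sym dy => /(_ xy).
Qed.

(** The summand of the log-sum inequality for the edge law. The point [z] is [y] or [x] according to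
    the direction in which the edge is traversed. *)
Lemma edge_law_ln x y (g : G -> R) z :
  edge_law x y * (ln (if adj x y then g z else 0) - ln (edge_law x y)) =
  edge_law x y * ln (g z) + edge_law x y * (ln (degree x)%:R - ln (p x)).
Proof.
rewrite /edge_law; case: ifP => [xy|]; last by rewrite !mul0r addr0.
have dx := adj_degree_gt0 xy.
rewrite ln_div ?posrE ?ltr0n //; last exact: p_admissible.2.
by ring.
Qed.

(** The log-sum inequality against the constant weight 1. *)
Lemma entropy_le_log_card (r : G -> R) : (forall x, 0 <= r x) -> \sum_x r x = 1 ->
  - \sum_x r x * ln (r x) <= ln (#|G|%:R).
Proof.
move=> r0 r1; have := @log_sum G r (fun=> 1) r0 (fun=> ler01) (fun _ _ => ltr01).
rewrite r1 mul1r ln1 subr0 sumr_const -sumrN; apply: le_trans.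
by apply: ler_sum => x _; rewrite sub0r mulrN.
Qed.

Lemma log_sum_root (g : G -> R) : admissible g ->
  \sum_x p x * ln (g x) + entropy <= ln (\sum_x g x).
Proof.
move=> [g0 gp]; have := @log_sum G p g p_admissible.1 g0 (fun x px => gp x (p_gt0_degree px)).
rewrite p_sum1 mul1r ln1 subr0; apply: le_trans.
by rewrite -sumrB le_eqVlt; apply/orP; left; apply/eqP; apply: eq_bigr => x _; rewrite mulrBr.
Qed.

(** The log-sum inequality over [y] for each fixed [x]. Given X = x, the variable Y is uniform on
    the neighbours, so its conditional entropy averages to [mean_log_degree]. *)
Lemma log_sum_to_end (g : G -> R) : admissible g ->
  \sum_y end_law y * ln (g y) + mean_log_degree <=
  \sum_x p x * ln (\sum_(y | adj x y) g y).
Proof.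
move=> [g0 gp]; rewrite sum_end_law_mean -big_split; apply: ler_sum => x _ /=.
have := @log_sum G (edge_law x) (fun y => if adj x y then g y else 0) (edge_law_ge0 x).
rewrite sum_edge_law -big_mkcond (eq_bigr _ (fun y _ => edge_law_ln x y g y)).
rewrite big_split /= -mulr_suml sum_edge_law => h.
suff : \sum_i edge_law x i * ln (g i) + p x * (ln (degree x)%:R - ln (p x)) <=
       p x * (ln (\sum_(i | adj x i) g i) - ln (p x)) by lra.
apply: h => y; first by case: ifP.
rewrite /edge_law; case: ifP => [xy _|]; last by rewrite ltxx.
by apply: gp; apply: (@adj_degree_gt0 y x); rewrite adj_sym.
Qed.

(** The log-sum inequality over [x] for each fixed [y]. The conditional entropy of X given Y is h(X,
    Y) - h(Y), where h(X, Y) is [mean_log_degree + entropy] and h(Y) is at most the logarithm of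
    [#|G|]. *)
Lemma log_sum_to_start (g : G -> R) : admissible g ->
  \sum_x p x * ln (g x) + mean_log_degree + entropy - ln (#|G|%:R) <=
  \sum_y end_law y * ln (\sum_(x | adj y x) g x).
Proof.
move=> [g0 gp].
have ent := entropy_le_log_card end_law_ge0 sum_end_law.
suff : \sum_x p x * ln (g x) + mean_log_degree + entropy <=
  \sum_y end_law y * (ln (\sum_(x | adj y x) g x) - ln (end_law y)).
  under [leRHS]eq_bigr do rewrite mulrBr; rewrite sumrB; lra.
have -> : \sum_x p x * ln (g x) + mean_log_degree + entropy =
  \sum_y \sum_x (edge_law x y * ln (g x) + edge_law x y * (ln (degree x)%:R - ln (p x))).
  under [RHS]eq_bigr do rewrite big_split.
  rewrite big_split /= (sum_edge_law_mean (fun x => ln (g x))).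
  rewrite (sum_edge_law_mean (fun x => ln (degree x)%:R - ln (p x))) -addrA.
  by congr (_ + _); rewrite /mean_log_degree /entropy -sumrB; apply: eq_bigr => x _; rewrite mulrBr.
apply: ler_sum => y _.
rewrite (eq_bigr _ (fun x _ => esym (edge_law_ln x y g x))).
rewrite (eq_bigl _ _ (fun x => adj_sym y x)) [X in ln X]big_mkcond.
apply: log_sum => x; first exact: edge_law_ge0.
  by case: ifP.
rewrite /edge_law; case: ifP => [xy _|]; last by rewrite ltxx.
exact: gp (adj_degree_gt0 xy).
Qed.

(** * Weighted homomorphism counts on a tree *)

Section Tree.
Variables (H : sgraph) (A : {set H}).
Hypothesis A_bip : forall u v : H, adj u v -> (u \in A) = (v \notin A).

Definition vertex_law (v : H) : G -> R := if v \in A then p else end_law.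

(* [f] is defined on all of [H]: its values outside [S] are free, which
   multiplies the count by [#|G| ^ (#|H| - #|S|)]. *)
Definition hom_on (S : {set H}) (f : {ffun H -> G}) : bool :=
  [forall u in S, forall v in S, adj u v ==> adj (f u) (f v)].

Definition weighted_homs (S : {set H}) (g : H -> G -> R) : R :=
  \sum_(f : {ffun H -> G} | hom_on S f) \prod_(v in S) g v (f v).

Definition update (v : H) (f : {ffun H -> G}) (y : G) : {ffun H -> G} :=
  [ffun w => if w == v then y else f w].

(* (f, y) |-> (f with the value y at v, f v) is an involution. *)
Lemma sum_update (v : H) (F : {ffun H -> G} -> R) :
  \sum_f \sum_y F (update v f y) = #|G|%:R * \sum_f F f.
Proof.
pose swap (q : {ffun H -> G} * G) := (update v q.1 q.2, q.1 v).
have swapK : involutive swap.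
  move=> [f y]; rewrite /swap /=; congr (_, _); last by rewrite ffunE eqxx.
  by apply/ffunP=> w; rewrite !ffunE; case: eqP => [->|].
rewrite pair_bigA /= (reindex_inj (inv_inj swapK)) /=.
rewrite -(pair_bigA _ (fun f y => F (update v (update v f y) (f v)))) /=.
rewrite mulr_sumr; apply: eq_bigr => f _.
rewrite (eq_bigr (fun=> F f)) ?sumr_const -?[LHS]mulr_natl // => y _; congr F.
by apply/ffunP=> w; rewrite !ffunE; case: eqP => [->|].
Qed.

(** A single vertex imposes no edge condition, and all values away from [r] are free; the factor
    [#|G|] on the left avoids the exponent [#|H| - 1]. *)
Lemma weighted_homs_root (r : H) (g : H -> G -> R) :
  #|G|%:R * weighted_homs [set r] g = (#|G| ^ #|H|)%:R * \sum_x g r x.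
Proof.
rewrite /weighted_homs big_mkcond -(sum_update r) (eq_bigr (fun=> \sum_x g r x)).
  by rewrite sumr_const -[LHS]mulr_natl card_ffun.
move=> f _; apply: eq_bigr => y _; rewrite big_set1 ffunE eqxx ifT //.
apply/forall_inP=> a /set1P->; apply/forall_inP=> b /set1P->.
by rewrite adj_irrefl.
Qed.

(* Summing over the value at the leaf [v] turns its weight into a factor of the
   weight of its neighbour [u]. *)
Definition absorb_leaf (g : H -> G -> R) (u v w : H) (x : G) : R :=
  if w == u then g u x * \sum_(y | adj x y) g v y else g w x.

Lemma hom_on_leaf (S : {set H}) (u v : H) (f : {ffun H -> G}) y :
  u \in S -> v \notin S -> adj u v -> (forall w, w \in S -> adj w v -> w = u) ->
  hom_on (v |: S) (update v f y) = hom_on S f && adj (f u) y.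
Proof.
move=> uS vS uv uniq.
have nv w : w \in S -> (w == v) = false by move=> wS; apply: contraNF vS => /eqP<-.
apply/forall_inP/andP.
- move=> h; split.
    apply/forall_inP=> a aS; apply/forall_inP=> b bS; apply/implyP=> ab.
    have /forall_inP/(_ b)/implyP := h a (setU1r _ aS).
    by rewrite !ffunE !nv // setU1r // ab.
  have /forall_inP/(_ v (setU11 _ _)) := h u (setU1r _ uS).
  by rewrite uv !ffunE nv // eqxx.
- case=> /forall_inP h uy a /setU1P[->|aS]; apply/forall_inP=> b /setU1P[->|bS]; apply/implyP.
  + by rewrite adj_irrefl.
  + by rewrite adj_sym => bv; rewrite (uniq b) // !ffunE eqxx nv // adj_sym.
  + by move=> av; rewrite (uniq a) // !ffunE eqxx nv.
  + by rewrite !ffunE !nv //; have /forall_inP/(_ b bS)/implyP := h a aS.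
Qed.

(** The factor [#|G|] balances the right-hand side, where the value at [v] is free. *)
Lemma weighted_homs_leaf (S : {set H}) (u v : H) (g : H -> G -> R) :
  u \in S -> v \notin S -> adj u v -> (forall w, w \in S -> adj w v -> w = u) ->
  #|G|%:R * weighted_homs (v |: S) g = weighted_homs S (absorb_leaf g u v).
Proof.
move=> uS vS uv uniq.
rewrite /weighted_homs big_mkcond -(sum_update v) [RHS]big_mkcond.
apply: eq_bigr => f _; rewrite (eq_bigr _ (fun y _ => congr1 (fun b : bool => if b then _ else 0) (hom_on_leaf f y uS vS uv uniq))).
case: (hom_on S f) => /=; last by rewrite big1.
rewrite -big_mkcond /= (bigD1 u) //= /absorb_leaf eqxx mulrAC mulr_sumr.
apply: eq_bigr => y _; rewrite big_setU1 //= ffunE eqxx mulrC; congr (_ * _).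
have nv w : w \in S -> (w == v) = false by move=> wS; apply: contraNF vS => /eqP<-.
rewrite (bigD1 u) //= ffunE nv //; congr (_ * _).
by apply: eq_bigr => w /andP[wS /negPf wu]; rewrite ffunE nv // wu.
Qed.

Lemma absorb_leaf_admissible (g : H -> G -> R) u v w :
  (forall w, admissible (g w)) -> admissible (absorb_leaf g u v w).
Proof.
move=> g_adm; have [gu0 gup] := g_adm u; rewrite /absorb_leaf.
split=> x; case: eqP => _; try by move=> *; apply: (g_adm w).1 || apply: (g_adm w).2.
- by rewrite mulr_ge0 ?gu0 // sumr_ge0 // => y _; exact: (g_adm v).1.
- by move=> dx; rewrite mulr_gt0 ?gup //; apply: admissible_sum_adj.
Qed.

Lemma vertex_law_isolated v x : degree x = 0%N -> vertex_law v x = 0.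
Proof. by rewrite /vertex_law; case: ifP => _; [exact: p_isolated|exact: end_law_isolated]. Qed.

(** The class of [v] decides the direction of the edge: a leaf in [A] is reached from Y to X, which
    adds h(X) - log N. *)
Lemma log_sum_edge (u v : H) (g : G -> R) : adj u v -> admissible g ->
  \sum_y vertex_law v y * ln (g y) + mean_log_degree +
    (v \in A)%:R * (entropy - ln (#|G|%:R)) <=
  \sum_x vertex_law u x * ln (\sum_(y | adj x y) g y).
Proof.
move=> uv g_adm; rewrite /vertex_law (A_bip uv).
case: (v \in A) => /=; rewrite ?mul1r ?mul0r ?addr0.
  by rewrite addrA log_sum_to_start.
exact: log_sum_to_end.
Qed.

(** The weights are quantified inside the induction because removing a leaf changes them. The root
    contributes h(X), each edge D, each further vertex of [A] the amount h(X) - log N, and each free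
    vertex outside [S] log N. *)
Lemma log_weighted_homs (r : H) (S : {set H}) : r \in A -> grown r S ->
  forall g : H -> G -> R, (forall v, admissible (g v)) ->
  0 < weighted_homs S g /\
  \sum_(v in S) \sum_x vertex_law v x * ln (g v x) +
    (#|S|%:R - 1) * mean_log_degree + #|S :&: A|%:R * entropy
    - (#|S :&: A|%:R - 1) * ln (#|G|%:R) + (#|H|%:R - #|S|%:R) * ln (#|G|%:R) <=
  ln (weighted_homs S g).
Proof.
move=> rA; have [x0 px0] : exists x, 0 < p x.
  apply/existsP; have := oner_neq0 R; rewrite -p_sum1; apply: contraNT.
  rewrite negb_exists => /forallP h; apply/eqP/big1 => x _.
  by apply/eqP; rewrite eq_le p_admissible.1 leNgt h.
have N0 : (0 < #|G|)%N by apply/card_gt0P; exists x0.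
have NR : 0 < #|G|%:R :> R by rewrite ltr0n.
elim=> [|S' u v gS IH uS vS uv uniq] g g_adm.
- have gr : 0 < \sum_x g r x.
    rewrite (bigD1 x0) //=; apply: ltr_pwDl; first exact: (g_adm r).2 (p_gt0_degree px0).
    by apply: sumr_ge0 => *; exact: (g_adm r).1.
  have eqw := weighted_homs_root r g.
  have NHR : 0 < (#|G| ^ #|H|)%:R :> R by rewrite ltr0n expn_gt0 N0.
  have w0 : 0 < weighted_homs [set r] g.
    by rewrite -(pmulr_rgt0 _ NR) eqw mulr_gt0.
  split=> //.
  have /esym := congr1 (@ln R) eqw; rewrite !lnM ?posrE // natrX lnXn //.
  have -> : [set r] :&: A = [set r] by apply/setIidPl; rewrite sub1set.
  rewrite big_set1 cards1 -[ln _ *+ _]mulr_natl.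
  have := log_sum_root (g_adm r); rewrite /vertex_law rA; lra.
- have eqw := weighted_homs_leaf g uS vS uv uniq.
  have [w0 IHg] := IH _ (fun w => absorb_leaf_admissible u v w g_adm).
  have w1 : 0 < weighted_homs (v |: S') g by rewrite -(pmulr_rgt0 _ NR) eqw.
  split=> //.
  have lnw := congr1 (@ln R) eqw; rewrite lnM ?posrE // in lnw.
  have cardA : #|(v |: S') :&: A|%:R = #|S' :&: A|%:R + (v \in A)%:R :> R.
    rewrite -natrD; congr _%:R; rewrite setIUl.
    have [vA|vA] := boolP (v \in A).
      have -> : [set v] :&: A = [set v] by apply/setIidPl; rewrite sub1set.
      by rewrite cardsU1 inE (negPf vS) addnC.
    have -> : [set v] :&: A = set0.
      by apply/setP=> w; rewrite !inE; case: eqP => // ->; rewrite (negPf vA).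
    by rewrite set0U addn0.
  rewrite cardA cardsU1 vS natrD big_setU1 //=.
  move: IHg; rewrite -lnw (bigD1 u) //= => IHg.
  rewrite [\sum_(w in S') _](bigD1 u) //=; move: IHg.
  have -> : \sum_x vertex_law u x * ln (absorb_leaf g u v u x) =
    \sum_x vertex_law u x * ln (g u x) +
    \sum_x vertex_law u x * ln (\sum_(y | adj x y) g v y).
    rewrite -big_split; apply: eq_bigr => x _ /=; rewrite /absorb_leaf eqxx.
    (* At an isolated vertex the product is 0 and its logarithm does not split, but the law vanishes
       there. *)
    have [dx|dx] := posnP (degree x); first by rewrite vertex_law_isolated // !mul0r addr0.
    by rewrite lnM ?mulrDr // posrE ?(g_adm u).2 ?admissible_sum_adj.
  have -> : \sum_(w in S' | w != u) \sum_x vertex_law w x * ln (absorb_leaf g u v w x) =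
            \sum_(w in S' | w != u) \sum_x vertex_law w x * ln (g w x).
    apply: eq_bigr.
    by move=> w /andP[_ /negPf wu]; apply: eq_bigr => x _; rewrite /absorb_leaf wu.
  have := log_sum_edge uv (g_adm v).
  rewrite mulrDr mulrDl; lra.
Qed.

End Tree.
End Law.
End Entropy.

(** * The theorem *)

Lemma bipartition_adj (H : sgraph) (A B : {set H}) (u v : H) :
  bipartition A B -> adj u v -> (u \in A) = (v \notin A).
Proof.
case/and4P=> /eqP AB _ /forall_inP indA /forall_inP indB uv.
have inAB w : (w \in A) || (w \in B) by rewrite -in_setU AB inE.
have [uA|uA] := boolP (u \in A); have [vA|vA] := boolP (v \in A) => //.
  by have /forall_inP/(_ v vA) := indA u uA; rewrite uv.
have uB : u \in B by have := inAB u; rewrite (negPf uA).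
have vB : v \in B by have := inAB v; rewrite (negPf vA).
by have /forall_inP/(_ v vB) := indB u uB; rewrite uv.
Qed.

Lemma num_edges_star (n : nat) : num_edges (star n.+1) = n.
Proof.
pose e (i : 'I_n) : {set star n.+1} := [set ord0; lift ord0 i].
have e_inj : injective e.
  move=> i j /setP/(_ (lift ord0 i)); rewrite !inE eqxx orbT => /esym.
  by case/orP=> /eqP; [move/(congr1 val)|move/lift_inj].
rewrite /num_edges -[RHS]card_ord -(card_imset _ e_inj); apply: eq_card => s.
apply/imsetP/imsetP.
- case=> -[x y]; rewrite inE /= /star_adj => xy ->.
  have [x0|x0] := eqVneq x ord0; have [y0|y0] := eqVneq y ord0.
  + by rewrite x0 y0 in xy.
  + have /unlift_some[j -> _] : ord0 != y by rewrite eq_sym.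
    by exists j; rewrite // x0.
  + have /unlift_some[j -> _] : ord0 != x by rewrite eq_sym.
    by exists j => //; rewrite y0 /= /e [RHS]setUC.
  + by move: x0 y0 xy; rewrite -!val_eqE /= => /negPf-> /negPf->.
- by case=> i _ ->; exists (ord0, lift ord0 i); rewrite ?inE.
Qed.

(** * From entropy to homomorphism counts *)

Section LowerBound.
Variable R : realType.
Local Open Scope ring_scope.

(** The weighted bound with all weights 1 on the whole tree; the root is taken in [A]. *)
Lemma log_num_homs_tree (G H : sgraph) (A B : {set H}) (p : G -> R) :
  is_tree H -> bipartition A B -> A != set0 ->
  admissible p -> (forall x, degree x = 0%N -> p x = 0) -> \sum_x p x = 1 ->
  (0 < num_homs H G)%N /\
  (num_edges H)%:R * mean_log_degree p + #|A|%:R * entropy p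
    - (#|A|%:R - 1) * ln #|G|%:R <= ln (num_homs H G)%:R.
Proof.
move=> Ht AB /set0Pn[r rA] p_adm p_iso p1.
have adm1 : forall v : H, admissible (fun _ : G => 1 : R) by [].
have whE : weighted_homs [set: H] (fun _ (_ : G) => 1 : R) = (num_homs H G)%:R.
  transitivity (\sum_(f : {ffun H -> G} | hom_on [set: H] f) 1 : R).
    by apply: eq_bigr => f _; rewrite big1.
  rewrite sumr_const /num_homs cardsE; congr (_ *+ _); apply: eq_card => f.
  rewrite -!topredE /= /hom_on /is_hom.
  by apply: eq_forallb => x; rewrite inE; apply: eq_forallb => y; rewrite inE.
have := log_weighted_homs p_adm p_iso p1 (fun u v => bipartition_adj AB) rA (tree_grown r Ht) adm1.
rewrite whE ltr0n => -[h0 h]; split=> //; apply: le_trans h.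
rewrite big1 => [|v _]; last by rewrite big1 // => x _; rewrite ln1 mulr0.
rewrite setTI cardsT -(tree_num_edges Ht) -natr1.
lra.
Qed.

Lemma num_homs_tree_star (n : nat) (G H : sgraph) (A B : {set H}) :
  (0 < n)%N -> is_tree H -> bipartition A B -> A != set0 ->
  (n * #|A| <= num_edges H)%N -> (0 < num_homs (star n.+1) G)%N ->
  (num_homs (star n.+1) G ^ num_edges H * #|G| ^ (#|H| * n) <=
   num_homs H G ^ n * #|G| ^ (n.+1 * num_edges H))%N.
Proof.
move=> n0 Ht AB A0 nA Z0.
set Z := num_homs _ _ in Z0 *; pose ZR : R := Z%:R.
have ZR0 : 0 < ZR by rewrite ltr0n.
have ZE : ZR = \sum_(x : G) (degree x)%:R ^+ n.
  by rewrite /ZR /Z num_homs_star natr_sum; apply: eq_bigr => x _; rewrite natrX.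
pose p (x : G) : R := (degree x)%:R ^+ n / ZR.
have p_adm : admissible p.
  split=> x; first by rewrite divr_ge0 ?exprn_ge0 // ltW.
  by move=> dx; rewrite divr_gt0 // exprn_gt0 // ltr0n.
have p_iso x : degree x = 0%N -> p x = 0.
  by move=> dx; rewrite /p dx expr0n -[n == 0%N]negbK -lt0n n0 mul0r.
have p1 : \sum_x p x = 1 by rewrite -mulr_suml -ZE divff // gt_eqF.
have G0 : (0 < #|G|)%N.
  rewrite lt0n; apply: contraTneq ZR0 => /card0_eq G0.
  by rewrite ZE big1 ?ltxx // => x; have := G0 x; rewrite inE.
(* Off isolated vertices [ln (p x)] is n log d(x) - log Z; at isolated ones [p] is 0. *)
have entE : entropy p = ln ZR - n%:R * mean_log_degree p.
  have -> : ln ZR = \sum_x p x * ln ZR by rewrite -mulr_suml p1 mul1r.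
  rewrite /entropy /mean_log_degree mulr_sumr -sumrN -sumrB; apply: eq_bigr => x _.
  have [dx|dx] := posnP (degree x); first by rewrite p_iso //; ring.
  rewrite [in ln (p x)]/p ln_div ?posrE ?exprn_gt0 ?ltr0n // lnXn ?ltr0n //.
  by rewrite -mulr_natl; ring.
have [h0 h] := log_num_homs_tree Ht AB A0 p_adm p_iso p1.
have ent := entropy_le_log_card p_adm.1 p1; rewrite -/(entropy p) in ent.
have GR : 0 < #|G|%:R :> R by rewrite ltr0n.
rewrite -(ler_nat R) -ler_ln ?posrE ?ltr0n ?muln_gt0 ?expn_gt0 ?G0 ?Z0 ?h0 //.
rewrite !natrM !natrX !lnM ?posrE ?exprn_gt0 ?ltr0n // !lnXn ?ltr0n // -/ZR.
rewrite -![ln _ *+ _]mulr_natl -(tree_num_edges Ht) !natrM -!natr1.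
have nR : 0 <= n%:R :> R by [].
(* After [n] times the bound [h] and the substitution of [entE], this product is exactly what
   remains to be nonnegative. *)
have slack : 0 <= ((num_edges H)%:R - n%:R * #|A|%:R) * (ln #|G|%:R - entropy p).
  by rewrite mulr_ge0 // subr_ge0 // -natrM ler_nat.
have := ler_wpM2l nR h.
rewrite entE in slack *; nra.
Qed.

End LowerBound.

Lemma hom_density_leE (H T G : sgraph) : 0 < #|G| ->
  (hom_density T G ^+ num_edges H <= hom_density H G ^+ num_edges T)%R =
  (num_homs T G ^ num_edges H * #|G| ^ (#|H| * num_edges T) <=
   num_homs H G ^ num_edges T * #|G| ^ (#|T| * num_edges H)).
Proof.
move=> G0; rewrite /hom_density /num_vertices !expr_div_n.
rewrite ler_pdivrMr ?exprn_gt0 ?ltr0n // mulrAC ler_pdivlMr ?exprn_gt0 ?ltr0n //.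
by rewrite -!exprM -!natrX -!natrM ler_nat.
Qed.

Theorem theorem1p6 (k : nat) (H : sgraph) (hk : 3 <= k)
    (H_nonempty : nonempty H) (H_tree : is_tree H) :
  dominates H (star k) <-> (k - 1) * sigma H <= num_edges H.
Proof.
case: k hk => [//|n] n2; rewrite subn1 /=.
have cardH := tree_num_edges H_tree; have n0 : 0 < n by lia.
split=> [dom|le_edges G].
- rewrite leqNgt; apply/negP => lt_edges.
  set m := num_edges H in cardH lt_edges *.
  (* The exponent [c] collects all factors 2: [m.+1 * n] from [num_homs_to_star], and [n.+1 * m]
     from bounding the [N.+1] vertices by [2 * N]. As [N] exceeds [2 ^ c], one surplus power of [N]
     gives a contradiction. *)
  pose c := m.+1 * n + n.+1 * m; pose N := (2 ^ c).+1.
  have := dom (star N.+1).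
  rewrite hom_density_leE ?card_ord // num_edges_star -/m -cardH => dom_N.
  have star_ge : N ^ n <= num_homs (star n.+1) (star N.+1).
    rewrite num_homs_star (bigD1 (ord0 : 'I_N.+1)) //=.
    suff -> : degree (ord0 : star N.+1) = N by rewrite leq_addr.
    rewrite /degree -[RHS](card_ord N) -cardsT.
    rewrite -(card_imset _ (@lift_inj _ (ord0 : 'I_N.+1))).
    apply: eq_card => j; rewrite !inE /= /star_adj /=; apply/idP/imsetP.
      move=> j0; have /unlift_some[i -> _] : ord0 != j by rewrite -val_eqE eq_sym.
      by exists i.
    by case=> i _ ->.
  have H_le := @num_homs_to_star H N isT; rewrite -cardH in H_le.
  (* This keeps the truncated subtraction in [E] exact. *)
  have sig : sigma H <= m.+1.
    rewrite cardH; case: (sigma_attained H) => [-> //|[A [B [_ <-]]]].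
    exact: max_card.
  pose E := (m.+1 - sigma H) * n + n.+1 * m.
  have N_le : N.+1 <= 2 * N by lia.
  have step1 : (N ^ n) ^ m * N ^ (m.+1 * n) <= 2 ^ c * N ^ E.
    apply: leq_trans (leq_trans _ dom_N) _.
      by apply: leq_mul; rewrite leq_exp2r ?muln_gt0 ?n0 // leqnSn.
    apply: (@leq_trans ((2 ^ m.+1 * N ^ (m.+1 - sigma H)) ^ n * (2 * N) ^ (n.+1 * m))).
      by apply: leq_mul; rewrite leq_exp2r ?muln_gt0 ?H_nonempty.
    have powE a b d M : (2 ^ a * M ^ b) ^ n * (2 * M) ^ d = 2 ^ (a * n + d) * M ^ (b * n + d).
      by rewrite !expnMn -!expnM !expnD mulnACA.
    by rewrite powE.
  (* The comparison of exponents amounts to [m < n * sigma H], the negated edge condition. *)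
  have step2 : N ^ E.+1 <= (N ^ n) ^ m * N ^ (m.+1 * n).
    rewrite -expnM -expnD leq_pexp2l // /E; nia.
  have := leq_trans step2 step1.
  by rewrite expnS leq_pmul2r ?expn_gt0 // ltnn.
- have [sigH|[A [B [AB cA]]]] := sigma_attained H.
    (* The default value of the minimum would give [n * m.+1 <= m], with [m] the number of edges. *)
    by move: le_edges; rewrite sigH -cardH; nia.
  have A0 : A != set0.
    move: H_nonempty => /card_gt0P[e /imsetP[[u v]]]; rewrite inE /= => uv _.
    apply/eqP => A0; have := bipartition_adj AB uv; by rewrite A0 !inE.
  (* The zero case also covers a graph [G] without vertices. *)
  have [Z0|Z0] := posnP (num_homs (star n.+1) G).
    rewrite {1}/hom_density Z0 mul0r expr0n eqn0Ngt (H_nonempty : 0 < num_edges H).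
    by rewrite exprn_ge0 // divr_ge0 // exprn_ge0.
  have G0 : 0 < #|G|.
    rewrite lt0n; apply: contraTneq Z0 => /card0_eq G0.
    by rewrite num_homs_star big1 // => x; have := G0 x; rewrite inE.
  rewrite hom_density_leE // num_edges_star card_ord.
  (* The inequality is between naturals; the reals serve only its proof, and any model of them would
     do. *)
  apply: (@num_homs_tree_star Rdefinitions.R n G H A B) => //.
  by rewrite cA.
Qed.
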